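(* Let $(M,g)$ be a semi-Riemannian space form, let $\varphi:M\to\mathbb{R}$ be an isoparametric function, with smooth $a,b:\mathbb{R}\to\mathbb{R}$ satisfying $\square_g\varphi=a(\varphi)$ and $\langle\operatorname{grad}_g\varphi,\operatorname{grad}_g\varphi\rangle_g=b(\varphi)$, and let $\Psi:\mathbb{R}\to\mathbb{R}$ be a continuous function. Then $u:=v\circ\varphi$ satisfies $$-\square_g u=\Psi(u)\quad\text{on }M$$ if and only if $v:\operatorname{Im}\varphi\to\mathbb{R}$ is a solution to $$-b(t)v''-a(t)v'=\Psi(v)\quad\text{on }\operatorname{Im}\varphi.$$
   Context: $\square_g=\operatorname{div}_g\operatorname{grad}_g$ is the Laplacian of the semi-Riemannian metric $g$. A smooth function $\varphi:M\to\mathbb{R}$ is isoparametric if there exist smooth $a,b:\mathbb{R}\to\mathbb{R}$ with $\square_g\varphi=a(\varphi)$ and $\langle\operatorname{grad}_g\varphi,\operatorname{grad}_g\varphi\rangle_g=b(\varphi)$. Solutions are classical (twice differentiable).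
   Formalization: The function v is assumed twice differentiable on Im φ (one-sided at end points) from the outset; otherwise ''only if'' fails, e.g. φ=|x|² on Euclidean space with v=1+t+t^{3/2}, where u is a C² solution for a continuous Ψ but v is not twice differentiable at 0. *)

(* Defs.v *)
From HB Require Import structures.
From mathcomp Require Import all_boot all_order all_algebra.
From mathcomp Require Import all_classical all_reals all_analysis.

Set Implicit Arguments.
Unset Strict Implicit.
Unset Printing Implicit Defensive.

Import Order.TTheory GRing.Theory Num.Theory.
Import numFieldNormedType.Exports.

Local Open Scope classical_set_scope.
Local Open Scope ring_scope.

Section EuclideanCalculus.
Context {R : realType} {n : nat}.

Definition partial (i : 'I_n) (f : 'rV[R]_n -> R) : 'rV[R]_n -> R :=
  'D_(delta_mx 0 i) f.

Definition iter_partial (s : seq 'I_n) (f : 'rV[R]_n -> R) : 'rV[R]_n -> R :=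
  foldr partial f s.

(* C^oo on an open set U: differentiability is Frechet differentiability, so
   every iterated partial derivative exists and is continuous on U. *)
Definition smooth_on (U : set 'rV[R]_n) (f : 'rV[R]_n -> R) : Prop :=
  forall (s : seq 'I_n) (x : 'rV[R]_n), U x -> differentiable (iter_partial s f) x.

Definition twice_differentiable_on (U : set 'rV[R]_n) (f : 'rV[R]_n -> R) : Prop :=
  forall x, U x ->
    differentiable f x /\ forall i, differentiable (partial i f) x.

Definition inner (G : 'M[R]_n) (v w : 'rV[R]_n) : R := (v *m G *m w^T) 0 0.

Definition negative_definite_on (G W : 'M[R]_n) : Prop :=
  forall v : 'rV[R]_n, (v <= W)%MS -> v != 0 -> inner G v v < 0.

(* The index of a symmetric bilinear form: the largest dimension of a subspace
   (given as the row space of W) on which the form is negative definite. *)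
Definition has_index (G : 'M[R]_n) (k : nat) : Prop :=
  (exists2 W : 'M[R]_n, negative_definite_on G W & \rank W = k) /\
  (forall W : 'M[R]_n, negative_definite_on G W -> (\rank W <= k)%N).

End EuclideanCalculus.

Section OneVariable.
Context {R : realType}.

Definition smooth_curve_at (V : normedModType R) (x : R -> V) (t : R) : Prop :=
  forall k : nat, derivable (derive1n k x) t 1.

Definition smooth_real (f : R -> R) : Prop := forall t, smooth_curve_at f t.

(* v1 is a derivative of v relative to D (one-sided at the endpoints when D is
   an interval); only the values on D of v and v1 matter.  At an isolated point
   of D every value is a relative derivative. *)
Definition is_derive_within (D : set R) (v v1 : R -> R) : Prop :=
  forall t, D t -> (v s - v t) / (s - t) @[s --> within D t^'] --> v1 t.

Definition twice_differentiable_within (D : set R) (v : R -> R) : Prop :=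
  exists v1 v2, is_derive_within D v v1 /\ is_derive_within D v1 v2.

End OneVariable.

Section Manifold.
Context {R : realType}.

(* A homeomorphism from the open set [dom] onto an open subset of R^n.  The
   maps [coords] and [param] are total functions; their values outside [dom] and
   outside [img] are irrelevant. *)
Record chart (n : nat) (M : topologicalType) := Chart {
  dom : set M;
  coords : M -> 'rV[R]_n;
  param : 'rV[R]_n -> M;
  dom_open : open dom;
  img_open : open (coords @` dom);
  coordsK : forall p, dom p -> param (coords p) = p;
  coords_continuous : {within dom, continuous coords};
  param_continuous : {within coords @` dom, continuous param}
}.

Definition img n M (c : chart n M) : set 'rV[R]_n := coords c @` dom c.

Definition transition n M (c d : chart n M) : 'rV[R]_n -> 'rV[R]_n :=
  coords d \o param c.

Definition overlap n M (c d : chart n M) : set 'rV[R]_n :=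
  coords c @` (dom c `&` dom d).

Record smooth_structure (n : nat) (M : topologicalType) := SmoothStructure {
  atlas : set (chart n M);
  atlas_cover : forall p : M, exists2 c, atlas c & dom c p;
  atlas_smooth : forall c d, atlas c -> atlas d ->
    forall j, smooth_on (overlap c d) (fun x => transition c d x 0 j);
  manifold_hausdorff : hausdorff_space M;
  manifold_second_countable : @second_countable M
}.

Definition smooth_function n M (S : smooth_structure n M) (u : M -> R) : Prop :=
  forall c, atlas S c -> smooth_on (img c) (u \o param c).

Definition twice_differentiable n M (S : smooth_structure n M) (u : M -> R) : Prop :=
  forall c, atlas S c -> twice_differentiable_on (img c) (u \o param c).

(* [gram c x] is the matrix of the metric tensor, in the coordinate frame of the
   chart [c], at the point with coordinates [x].  Tangent vectors are rows of
   components, and ('J f x) i j is the i-th partial derivative of the j-th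
   component of f, so [gram_change] is the transformation law of a (0,2)-tensor. *)
Record semi_riemannian_metric n M (S : smooth_structure n M) := SemiRiemannianMetric {
  gram : chart n M -> 'rV[R]_n -> 'M[R]_n;
  gram_smooth : forall c, atlas S c ->
    forall i j, smooth_on (img c) (fun x => gram c x i j);
  gram_change : forall c d, atlas S c -> atlas S d -> forall x, overlap c d x ->
    gram c x = 'J (transition c d) x *m gram d (transition c d x)
                 *m ('J (transition c d) x)^T;
  gram_sym : forall c, atlas S c -> forall x, img c x -> (gram c x)^T = gram c x;
  gram_nondegenerate : forall c, atlas S c -> forall x, img c x ->
    gram c x \in unitmx;
  gram_index : exists k, forall c, atlas S c -> forall x, img c x ->
    has_index (gram c x) k
}.

Section Metric.
Context {n : nat} {M : topologicalType} {S : smooth_structure n M}.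
Variable g : semi_riemannian_metric S.
Implicit Types (c : chart n M) (x v w z : 'rV[R]_n).

Definition christoffel c (k i j : 'I_n) x : R :=
  2^-1 * \sum_(l < n) invmx (gram g c x) k l *
    (partial i (fun y => gram g c y j l) x + partial j (fun y => gram g c y i l) x
     - partial l (fun y => gram g c y i j) x).

Definition gradient c (u : M -> R) x : 'rV[R]_n :=
  (\row_j partial j (u \o param c) x) *m invmx (gram g c x).

(* The trace of the covariant differential of the vector field with components X. *)
Definition divergence c (X : 'rV[R]_n -> 'rV[R]_n) x : R :=
  \sum_(i < n) (partial i (fun y => X y 0 i) x
                + \sum_(j < n) christoffel c i i j x * X x 0 j).

Definition laplacian c (u : M -> R) (p : M) : R :=
  divergence c (gradient c u) (coords c p).

Definition gradient_sq c (u : M -> R) (p : M) : R :=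
  inner (gram g c (coords c p)) (gradient c u (coords c p)) (gradient c u (coords c p)).

(* The l-th component of R(d_i, d_j) d_k, with the convention
   R(X, Y) Z = D_X D_Y Z - D_Y D_X Z - D_[X, Y] Z. *)
Definition curvature_coef c (l k i j : 'I_n) x : R :=
  partial i (christoffel c l j k) x - partial j (christoffel c l i k) x
  + \sum_(m < n) (christoffel c l i m x * christoffel c m j k x
                  - christoffel c l j m x * christoffel c m i k x).

Definition curvature c x v w z : 'rV[R]_n :=
  \row_l \sum_(i < n) \sum_(j < n) \sum_(k < n)
    v 0 i * w 0 j * z 0 k * curvature_coef c l k i j x.

(* The plane spanned by v and w is nondegenerate iff [area_form c x v w != 0]. *)
Definition area_form c x v w : R :=
  inner (gram g c x) v v * inner (gram g c x) w w - inner (gram g c x) v w ^+ 2.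

Definition sectional_curvature c x v w : R :=
  inner (gram g c x) (curvature c x v w w) v / area_form c x v w.

Definition constant_curvature : Prop :=
  exists K : R, forall c, atlas S c -> forall x, img c x ->
    forall v w, area_form c x v w != 0 -> sectional_curvature c x v w = K.

Definition geodesic_on (I : set R) (gamma : R -> M) : Prop :=
  (forall t, I t -> {for t, continuous gamma}) /\
  forall c t, atlas S c -> I t -> dom c (gamma t) ->
    let x := coords c \o gamma in
    smooth_curve_at x t /\
    forall k, derive1n 2 x t 0 k
      + \sum_(i < n) \sum_(j < n) christoffel c k i j (x t)
          * derive1 x t 0 i * derive1 x t 0 j = 0.

Definition geodesically_complete : Prop :=
  forall (I : set R) (gamma : R -> M), open I -> is_interval I -> I !=set0 ->
    geodesic_on I gamma ->
    exists2 gamma' : R -> M, geodesic_on setT gamma' &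
      forall t, I t -> gamma' t = gamma t.

Definition space_form : Prop :=
  [/\ connected [set: M], geodesically_complete & constant_curvature].

(* The chart expressions [laplacian] and [gradient_sq] represent functions on M;
   equations between functions on M are required to hold in every chart. *)
Definition isoparametric (phi : M -> R) (a b : R -> R) : Prop :=
  [/\ smooth_function S phi, smooth_real a, smooth_real b,
      forall c p, atlas S c -> dom c p -> laplacian c phi p = a (phi p) &
      forall c p, atlas S c -> dom c p -> gradient_sq c phi p = b (phi p)].

Definition pde_solution (Psi : R -> R) (u : M -> R) : Prop :=
  twice_differentiable S u /\
  forall c p, atlas S c -> dom c p -> - laplacian c u p = Psi (u p).

End Metric.
End Manifold.

Arguments chart : clear implicits.
Arguments smooth_structure : clear implicits.

Definition ode_solution (R : realType) (D : set R) (a b Psi v : R -> R) : Prop :=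
  exists v1 v2, [/\ is_derive_within D v v1, is_derive_within D v1 v2 &
    forall t, D t -> - b t * v2 t - a t * v1 t = Psi (v t)].

(* Main.v *)
Require Import Defs.
From mathcomp Require Import all_boot all_order all_algebra.
From mathcomp Require Import all_classical all_reals all_analysis.

Import numFieldNormedType.Exports.

(** The proof is the identity
      lap (v \o phi) = v''(phi) * |grad phi|^2 + v'(phi) * lap phi
                     = b(phi) * v''(phi) + a(phi) * v'(phi),
    valid at every point of the manifold and in every chart
    ([laplacian_comp_isoparametric]).  Once it is known, the equation for
    [v \o phi] at a point p is the equation for v at t = phi p, and every t in
    the range of phi has this form.

    The first equality is local and holds for any smooth function phi on any
    semi-Riemannian manifold ([laplacian_comp]); the second is the
    isoparametric condition.  The first equality has two ingredients.
    - The chain rule when v is differentiable only relative to the range of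
      phi, a set which may have endpoints or be a single point.  Given a point
      t of the range, v can be replaced off the range by its affine
      approximation at t: this does not change [v \o phi], and the new function
      is differentiable at t in the usual sense, so the usual chain rule
      applies ([is_derive_within_comp]).  Applied to v and then to v', it also
      shows that [v \o phi] is twice differentiable
      ([twice_differentiable_comp]).
    - The Leibniz rule div (f X) = f div X + df(X) ([divergenceZ]), with
      X = grad phi and f = v'(phi), for which df(X) = v''(phi) |grad phi|^2.
      It needs the differentiability of the components of grad phi, hence of
      the inverse of the Gram matrix, which Cramer's rule provides
      ([differentiable_invmx]). *)

Set Implicit Arguments.
Unset Strict Implicit.
Unset Printing Implicit Defensive.

Import Order.TTheory GRing.Theory Num.Theory.

Local Open Scope classical_set_scope.
Local Open Scope ring_scope.

(** * Differentiability of sums, products, determinants and inverse matrices *)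

Section Differentiability.
Context {R : realType} {V : normedModType R}.
Implicit Types (x : V).

Lemma near_eq_differentiable (W : normedModType R) (f h : V -> W) x :
  {near x, f =1 h} -> differentiable f x -> differentiable h x.
Proof.
move=> fh df; have [dfc dfo] := (diff_locallyP x f).1 df.
have hx : h x = f x by rewrite (nbhs_singleton fh).
have ho : h \o shift x = cst (h x) + 'd f x +o_ 0 id.
  apply/eqaddoE/eqaddoP => e e0.
  have /eqaddoP /(_ e e0) dfe := dfo.
  have fh0 : \forall z \near (0 : V), f (z + x) = h (z + x).
    by rewrite (near_shift x)/= sub0r; near do rewrite /= addrNK//.
  near=> z.
  have -> : (h \o shift x - (cst (h x) + 'd f x)) z =
            (f \o shift x - (cst (f x) + 'd f x)) z.
    by rewrite /= !fctE /= hx -(near fh0 z).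
  by near: z.
have dhE := diff_unique dfc ho.
by apply/diff_locallyP; rewrite dhE.
Unshelve. all: by end_near. Qed.

Lemma differentiable_bigsum (I : Type) (r : seq I) (P : pred I)
    (F : I -> V -> R) x :
  (forall i, differentiable (F i) x) ->
  differentiable (fun y => \sum_(i <- r | P i) F i y) x.
Proof.
move=> dF; elim: r => [|i r IH].
  by under eq_fun do rewrite big_nil; exact: differentiable_cst.
under eq_fun do rewrite big_cons.
by case: (P i) => //; exact: differentiableD.
Qed.

Lemma differentiable_bigprod (I : Type) (r : seq I) (P : pred I)
    (F : I -> V -> R) x :
  (forall i, differentiable (F i) x) ->
  differentiable (fun y => \prod_(i <- r | P i) F i y) x.
Proof.
move=> dF; elim: r => [|i r IH].
  by under eq_fun do rewrite big_nil; exact: differentiable_cst.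
under eq_fun do rewrite big_cons.
by case: (P i) => //; exact: differentiableM.
Qed.

Lemma differentiable_det (n : nat) (A : V -> 'M[R]_n) x :
  (forall i j, differentiable (fun y => A y i j) x) ->
  differentiable (fun y => \det (A y)) x.
Proof.
move=> dA; apply: differentiable_bigsum => s.
apply: differentiableM; first exact: differentiable_cst.
exact: differentiable_bigprod.
Qed.

Lemma differentiable_invmx (n : nat) (A : V -> 'M[R]_n) x i j :
  (\forall y \near x, A y \in unitmx) ->
  (forall k l, differentiable (fun y => A y k l) x) ->
  differentiable (fun y => invmx (A y) i j) x.
Proof.
move=> uA dA.
apply: (@near_eq_differentiable _
  (fun y => (\det (A y))^-1 * cofactor (A y) j i)).
  by near=> y; rewrite /invmx (near uA y)// !mxE.
apply: differentiableM.
  apply: differentiableV; first exact: differentiable_det.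
  by rewrite -unitfE; exact: (nbhs_singleton uA).
apply: differentiableM; first exact: differentiable_cst.
apply: differentiable_det => k l.
by under eq_fun do rewrite !mxE; exact: dA.
Unshelve. all: by end_near. Qed.

End Differentiability.

(** * The chain rule for relative derivatives *)

Section ChainRule.
Context {R : realType}.
Implicit Types (D : set R) (v : R -> R).

(** The function equal to v on D, and to the affine function of slope d through
    (t, v t) off D. *)
Definition affine_extension D v (t d s : R) : R :=
  if pselect (D s) then v s else v t + d * (s - t).

Lemma is_derive_affine_extension D v (v1 : R -> R) t :
  is_derive_within D v v1 -> D t ->
  is_derive t 1 (affine_extension D v t (v1 t)) (v1 t).
Proof.
move=> dv Dt; set w := affine_extension D v t (v1 t).
have wt : w t = v t by rewrite /w /affine_extension; case: pselect.
have dw : h^-1 *: (w (h *: 1 + t) - w t) @[h --> 0^'] --> v1 t.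
  apply/cvgrPdist_lt => e e0.
  have /cvgrPdist_lt /(_ e e0) := dv t Dt.
  rewrite !near_withinE => Hd.
  have {}Hd : \forall s \near t, s != t -> D s ->
      `|v1 t - (v s - v t) / (s - t)| < e by exact: Hd.
  rewrite (near_shift 0) /= subr0 in Hd.
  near=> h => h0.
  have hE : h *: 1 + t = h + t by rewrite /GRing.scale /= mulr1.
  rewrite hE wt /w /affine_extension; case: pselect => Dh.
    have : h + t != t -> D (h + t) ->
      `|v1 t - (v (h + t) - v t) / (h + t - t)| < e by near: h.
    rewrite addrK mulrC; apply => //.
    by rewrite -subr_eq0 addrK.
  rewrite addrK [v t + _]addrC addrK /GRing.scale /= mulrCA mulVf// mulr1.
  by rewrite subrr normr0.
split; first by apply/cvg_ex; exists (v1 t).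
exact/cvg_lim.
Unshelve. all: by end_near. Qed.

Lemma is_derive_within_comp (V : normedModType R) D v (v1 : R -> R) (f : V -> R) (x : V) :
  is_derive_within D v v1 -> (forall y, D (f y)) -> differentiable f x ->
  differentiable (v \o f) x /\
  forall e, 'D_e (v \o f) x = v1 (f x) * 'D_e f x.
Proof.
move=> dv Df df.
pose w := affine_extension D v (f x) (v1 (f x)).
have -> : v \o f = w \o f.
  by apply/funext => y; rewrite /= /w /affine_extension; case: pselect.
have wd : is_derive (f x) 1 w (v1 (f x)) := is_derive_affine_extension dv (Df x).
have dw : differentiable w (f x) by apply/derivable1_diffP.
split=> [|e]; first exact: differentiable_comp.
rewrite !deriveE//; last exact: differentiable_comp.
by rewrite diff_comp//= diff1E//= derive1E derive_val /GRing.scale/= mulrC.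
Qed.

End ChainRule.

(** * The Laplacian of a function of phi *)

Section Laplacian.
Context {R : realType} {n : nat} {M : topologicalType}.
Context {S : smooth_structure R n M} (g : semi_riemannian_metric S).
Implicit Types (c : chart R n M) (x : 'rV[R]_n) (u phi : M -> R).

Lemma near_img c x : img c x -> \forall y \near x, img c y.
Proof. by move=> xc; apply: open_nbhs_nbhs; split; [exact: img_open|]. Qed.

Lemma differentiable_gradient c phi x i :
  atlas S c -> smooth_function S phi -> img c x ->
  differentiable (fun y => gradient g c phi y 0 i) x.
Proof.
move=> Sc sphi xc; under eq_fun do rewrite mxE.
apply: differentiable_bigsum => j; apply: differentiableM.
  under eq_fun do rewrite mxE.
  exact: (sphi c Sc [:: j]).
apply: differentiable_invmx => [|k l].
  by near=> y; apply: gram_nondegenerate => //; near: y; exact: near_img.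
exact: (gram_smooth g Sc k l [::] xc).
Unshelve. all: by end_near. Qed.

Lemma near_eq_divergence c (X Y : 'rV[R]_n -> 'rV[R]_n) x :
  (\forall y \near x, X y = Y y) -> divergence g c X x = divergence g c Y x.
Proof.
move=> XY; apply: eq_bigr => i _; rewrite (nbhs_singleton XY); congr (_ + _).
by apply: near_eq_derive; near=> y; rewrite (near XY y).
Unshelve. all: by end_near. Qed.

Lemma divergenceZ c (f : 'rV[R]_n -> R) (X : 'rV[R]_n -> 'rV[R]_n) x :
  differentiable f x -> (forall i, differentiable (fun y => X y 0 i) x) ->
  divergence g c (fun y => f y *: X y) x =
  f x * divergence g c X x + \sum_i partial i f x * X x 0 i.
Proof.
move=> df dX; rewrite /divergence mulr_sumr -big_split; apply: eq_bigr => i _ /=.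
have -> : (fun y => (f y *: X y) 0 i) = f * (fun y => X y 0 i).
  by apply/funext => y; rewrite mxE.
rewrite /partial deriveM; [|exact: diff_derivable..].
rewrite /GRing.scale /= mulrDr mulr_sumr.
under [in LHS]eq_bigr do rewrite mxE mulrCA.
by rewrite [X x 0 i * _]mulrC addrAC.
Qed.

(** The metric pairs grad phi with a vector as d phi does, so |grad phi|^2 is
    the derivative of phi along its gradient. *)
Lemma inner_gradient c phi x : atlas S c -> img c x ->
  inner (gram g c x) (gradient g c phi x) (gradient g c phi x) =
  \sum_i partial i (phi \o param c) x * gradient g c phi x 0 i.
Proof.
move=> Sc xc; rewrite /inner {1}/gradient mulmxKV; last exact: gram_nondegenerate.
by rewrite mxE; apply: eq_bigr => i _; rewrite !mxE.
Qed.

Section Composition.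
Variables (phi : M -> R) (v v1 v2 : R -> R) (c : chart R n M).
Hypotheses (sphi : smooth_function S phi) (Sc : atlas S c).
Hypothesis dv : is_derive_within (range phi) v v1.
Hypothesis dv1 : is_derive_within (range phi) v1 v2.

Let range_param y : range phi ((phi \o param c) y).
Proof. by exists (param c y). Qed.

Let dphi x : img c x -> differentiable (phi \o param c) x.
Proof. exact: (sphi Sc [::]). Qed.

Lemma partial_comp i x : img c x ->
  partial i (v \o phi \o param c) x =
  v1 (phi (param c x)) * partial i (phi \o param c) x.
Proof.
move=> xc; have [_ dE] := is_derive_within_comp dv range_param (dphi xc).
exact: dE.
Qed.

Lemma twice_differentiable_comp :
  twice_differentiable_on (img c) (v \o phi \o param c).
Proof.
move=> x xc; split.
  by have [] := is_derive_within_comp dv range_param (dphi xc).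
move=> i; apply: (@near_eq_differentiable _ _ _
  (fun y => v1 (phi (param c y)) * partial i (phi \o param c) y)).
  by near=> y; rewrite partial_comp//; near: y; exact: near_img.
apply: differentiableM; last exact: (sphi Sc [:: i]).
by have [] := is_derive_within_comp dv1 range_param (dphi xc).
Unshelve. all: by end_near. Qed.

Lemma divergence_gradient_comp x : img c x ->
  divergence g c (gradient g c (v \o phi)) x =
  v1 (phi (param c x)) * divergence g c (gradient g c phi) x +
  v2 (phi (param c x)) *
    inner (gram g c x) (gradient g c phi x) (gradient g c phi x).
Proof.
move=> xc; have [df fE] := is_derive_within_comp dv1 range_param (dphi xc).
rewrite (@near_eq_divergence _ _
  (fun y => (v1 \o (phi \o param c)) y *: gradient g c phi y)).
  rewrite divergenceZ//; last by move=> i; exact: differentiable_gradient.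
  rewrite inner_gradient// mulr_sumr; congr (_ + _).
  by apply: eq_bigr => i _; rewrite mulrA /partial fE.
near=> y; rewrite /gradient scalemxAl; congr (_ *m _).
apply/rowP => j; rewrite !mxE partial_comp//.
by near: y; exact: near_img.
Unshelve. all: by end_near. Qed.

Lemma laplacian_comp p : dom c p ->
  laplacian g c (v \o phi) p =
  v1 (phi p) * laplacian g c phi p + v2 (phi p) * gradient_sq g c phi p.
Proof.
move=> cp; rewrite /laplacian divergence_gradient_comp; last by exists p.
by rewrite coordsK.
Qed.

End Composition.

Lemma laplacian_comp_isoparametric phi (a b v v1 v2 : R -> R) c p :
  isoparametric g phi a b ->
  is_derive_within (range phi) v v1 -> is_derive_within (range phi) v1 v2 ->
  atlas S c -> dom c p ->
  - laplacian g c (v \o phi) p = - b (phi p) * v2 (phi p) - a (phi p) * v1 (phi p).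
Proof.
move=> [sphi _ _ lapE gradE] dv dv1 Sc cp.
rewrite (laplacian_comp sphi Sc dv dv1 cp) lapE// gradE//.
by rewrite opprD addrC mulNr [v2 _ * _]mulrC [v1 _ * _]mulrC.
Qed.

End Laplacian.

Theorem proposition1p4 (R : realType) (n : nat) (M : topologicalType)
    (S : smooth_structure R n M) (g : semi_riemannian_metric S)
    (phi : M -> R) (a b Psi : R -> R) (v : R -> R) :
  space_form g ->
  isoparametric g phi a b ->
  continuous Psi ->
  twice_differentiable_within (range phi) v ->
  (pde_solution g Psi (v \o phi) <-> ode_solution (range phi) a b Psi v).
Proof.
move=> _ iso _ [w1 [w2 [dw dw1]]]; split=> [[_ pde]|[v1 [v2 [dv dv1 ode]]]].
  exists w1, w2; split=> // _ [p _ <-].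
  have [c Sc cp] := atlas_cover S p.
  by rewrite -(laplacian_comp_isoparametric iso dw dw1 Sc cp) pde.
split=> [c Sc|c p Sc cp].
  by have [sphi _ _ _ _] := iso; exact: (twice_differentiable_comp sphi Sc dv dv1).
rewrite (laplacian_comp_isoparametric iso dv dv1 Sc cp).
by apply: ode; exists p.
Qed.
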